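(* Let $n\ge 3$ and let $k_1,\ldots,k_n$ be integers with each $k_i\ge 2$. Let $G_1\subset G_2\subset\cdots\subset G_n$ be a stack of polygons of type $(k_1,\ldots,k_n)$, as defined in the context. Then the numbers of spanning trees satisfy $$\tau(G_n) = k_n\,\tau(G_{n-1}) - \tau(G_{n-2}),$$ i.e. $T(k_1,\ldots,k_n)=k_nT(k_1,\ldots,k_{n-1})-T(k_1,\ldots,k_{n-2})$, where $T(k_1,\ldots,k_m)=\tau(G_m)$ denotes the number of spanning trees of $G_m$.
   Context: Stacks of polygons: given integers $k_1,\ldots,k_n\ge 2$, let $G_1$ be a cycle of length $k_1$ (for $k_1=2$, two vertices joined by two parallel edges), and let $P_1$ denote its set of edges. For $2\le i\le n$, $G_i$ is obtained from $G_{i-1}$ by choosing two vertices joined by an edge of $P_{i-1}$ and adding between them a new path $P_i$ of $k_i-1$ edges with $k_i-2$ new internal vertices. Multiple edges are allowed. $\tau(\Gamma)$ denotes the number of spanning trees of a graph $\Gamma$. *)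

(* Defs.v *)
From mathcomp Require Import all_boot all_order all_algebra.

Set Implicit Arguments.
Unset Strict Implicit.
Unset Printing Implicit Defensive.

(* Finite multigraphs: [ends e] is the set of endpoints of the edge [e];
   parallel edges (and loops, when [#|ends e| = 1]) are allowed. *)
Record multigraph := Multigraph {
  vertex : finType;
  edge : finType;
  ends : edge -> {set vertex};
  endsP : forall e, 0 < #|ends e| <= 2
}.

Record subgraph (G : multigraph) := Subgraph {
  verts : {set vertex G};
  edges : {set edge G};
  subgraphP : forall e, e \in edges -> ends e \subset verts
}.

Definition joins (G : multigraph) (e : edge G) (u v : vertex G) : bool :=
  ends e == [set u; v].

(* [walk x [:: e1; ...; em] [:: v1; ...; vm]]: x, e1, v1, ..., em, vm is a walk,
   i.e. each edge joins the vertices next to it. *)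
Fixpoint walk (G : multigraph) (x : vertex G)
    (es : seq (edge G)) (vs : seq (vertex G)) : bool :=
  match es, vs with
  | [::], [::] => true
  | e :: es', v :: vs' => joins e x v && walk v es' vs'
  | _, _ => false
  end.

(* A cycle of length [size es = size vs]: distinct vertices and distinct edges,
   the first edge joining the last vertex to the first one.  A cycle of length 2
   is a pair of parallel edges, a cycle of length 1 is a loop. *)
Definition is_cycle (G : multigraph)
    (es : seq (edge G)) (vs : seq (vertex G)) : bool :=
  if vs is x :: _ then [&& uniq es, uniq vs & walk (last x vs) es vs]
  else false.

(* The bound on the length makes this a boolean; see [acyclicP]. *)
Definition acyclic (G : multigraph) (T : {set edge G}) : bool :=
  ~~ [exists m : 'I_(#|edge G|.+1), exists es : m.-tuple (edge G),
        exists vs : m.-tuple (vertex G),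
        is_cycle es vs && all (fun e => e \in T) es].

Lemma walk_size (G : multigraph) (x : vertex G) es vs :
  walk x es vs -> size es = size vs.
Proof.
by elim: es x vs => [|e es IH] x [|v vs] //= /andP[_ /IH ->].
Qed.

Lemma acyclicP (G : multigraph) (T : {set edge G}) :
  reflect (~ exists es vs, is_cycle es vs /\ {subset es <= T}) (acyclic T).
Proof.
apply: (iffP idP) => [/existsPn noC [es [vs [Cesvs /allP sT]]] | noC].
  have [ues szE] : uniq es /\ size es = size vs.
    by case: vs Cesvs => // x vs /and3P[ues _ /walk_size].
  have lt_m : size es < #|edge G|.+1.
    by rewrite ltnS -(card_uniqP ues) max_card.
  case/negP: (noC (Ordinal lt_m)).
  apply/existsP; exists (in_tuple es); apply/existsP.
  have szV : size vs == size es by rewrite szE.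
  by exists (Tuple szV); rewrite Cesvs.
apply/existsPn => m; apply/negP => /existsP[es /existsP[vs /andP[C /allP sT]]].
by case: noC; exists es, vs.
Qed.

Definition adjacent (G : multigraph) (T : {set edge G}) : rel (vertex G) :=
  fun u v => [exists e in T, joins e u v].

Definition connected_on (G : multigraph)
    (W : {set vertex G}) (T : {set edge G}) : bool :=
  (W != set0) && [forall u in W, forall v in W, connect (adjacent T) u v].

(* A spanning tree of [H] is represented by its edge set [T]; its vertex set
   is [verts H].  As [T \subset edges H], walks along [T] from a vertex of [H]
   stay in [H]. *)
Definition spanning_tree (G : multigraph) (H : subgraph G)
    (T : {set edge G}) : bool :=
  [&& T \subset edges H, connected_on (verts H) T & acyclic T].

Definition tau (G : multigraph) (H : subgraph G) : nat :=
  #|[set T : {set edge G} | spanning_tree H T]|.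

Definition is_polygon (G : multigraph) (k : nat) (H : subgraph G) : Prop :=
  exists (es : seq (edge G)) (vs : seq (vertex G)),
    [/\ is_cycle es vs, size vs = k,
        verts H = [set v in vs] & edges H = [set e in es]].

(* [H'] is obtained from [H] by choosing two vertices [u], [v] joined by an edge
   of [P] and adding between them a new path with edge set [P'], made of
   [k - 1] edges [es] and [k - 2] new internal vertices [ws]. *)
Definition attach_path (G : multigraph) (k : nat)
    (H : subgraph G) (P : {set edge G})
    (H' : subgraph G) (P' : {set edge G}) : Prop :=
  exists (e : edge G) (u v : vertex G)
         (es : seq (edge G)) (ws : seq (vertex G)),
    [/\ e \in P /\ joins e u v,
        [/\ size es = k - 1, uniq es & [disjoint es & edges H]],
        [/\ size ws = k - 2, uniq ws & [disjoint ws & verts H]],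
        walk u es (rcons ws v) &
        [/\ P' = [set f in es], verts H' = verts H :|: [set w in ws] &
            edges H' = edges H :|: P']].

(* [H 1, ..., H n] is a stack of polygons of type [(k 1, ..., k n)].  Indices
   start at 1; values of [k] and [H] outside [1, n] are irrelevant. *)
Definition stack_of_polygons (G : multigraph) (n : nat) (k : nat -> nat)
    (H : nat -> subgraph G) : Prop :=
  exists P : nat -> {set edge G},
    [/\ is_polygon (k 1) (H 1), P 1 = edges (H 1) &
        forall i, 2 <= i <= n ->
          attach_path (k i) (H i.-1) (P i.-1) (H i) (P i)].

(* Main.v *)
(** Let [t] count the spanning trees of a graph, and let [t2 u v] count its
    spanning forests with exactly two components, one containing [u] and the
    other one [v]. Joining [u] and [v] by a new path of [m] edges gives
    [t' = m * t + t2 u v]: build the path from [u], each edge to a new vertex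
    leaves [t] unchanged and moves [t2 u v] to [t + t2 u v], and the last edge
    [e] contributes [t(G + e) = t(G) + t2(G)]. If [u] and [v] are already joined
    by an edge [e], then [t2 u v] counts the trees that contain [e], so
    [t' = (m + 1) * t - t(G - e)]. When [e] belongs to the path added in the
    previous step, deleting it leaves two pendant paths, whence [t(G - e)] is
    the number of spanning trees of the graph before that step. *)
Require Import Defs.
From mathcomp Require Import all_boot all_order all_algebra.

Set Implicit Arguments.
Unset Strict Implicit.

Section SpanningTrees.

Variable G : multigraph.
Implicit Types (e f : edge G) (u v w x y z : vertex G).
Implicit Types (T E : {set edge G}) (W : {set vertex G}).
Implicit Types (es : seq (edge G)) (vs ws : seq (vertex G)).

Local Notation conn T := (connect (adjacent T)).

(** * Connectivity and walks *)

Lemma joinsC e u v : joins e u v = joins e v u.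
Proof. by rewrite /joins setUC. Qed.

Lemma joins_inj e u v x y :
  joins e u v -> joins e x y -> (x = u /\ y = v) \/ (x = v /\ y = u).
Proof.
move=> /eqP uv /eqP xy; rewrite uv in xy.
have: y \in [set u; v] by rewrite xy set22.
have: v \in [set x; y] by rewrite -xy set22.
have: u \in [set x; y] by rewrite -xy set21.
have: x \in [set u; v] by rewrite xy set21.
by do 4!(case/set2P=> ?); subst; auto.
Qed.

Lemma adjacent_sym T : symmetric (adjacent T).
Proof. by move=> x y; apply: eq_existsb => e; rewrite joinsC. Qed.

Lemma conn_sym T x y : conn T x y = conn T y x.
Proof. exact: (sym_connect_sym (adjacent_sym T)). Qed.

Lemma conn_edge T e u v : e \in T -> joins e u v -> conn T u v.
Proof. by move=> eT uv; apply/connect1/existsP; exists e; rewrite eT. Qed.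

Lemma conn_subset T E x y : T \subset E -> conn T x y -> conn E x y.
Proof.
move=> sTE; apply: connect_sub => a b /existsP[e /andP[eT ab]].
by apply: (conn_edge (subsetP sTE _ eT)).
Qed.

(** By induction on the path, several crossings of [e] reduce to at most one, in either
    direction. *)
Lemma conn_add T e u v x y : joins e u v ->
  conn (e |: T) x y =
  [|| conn T x y, conn T x u && conn T v y | conn T x v && conn T u y].
Proof.
move=> euv; have sT : T \subset e |: T by exact: subsetUr.
have Cuv : conn (e |: T) u v by apply: (conn_edge _ euv); rewrite setU11.
apply/idP/idP => [/connectP[p]|].
  elim: p x => [|z p IHp] x /=; first by move=> _ ->; rewrite connect0.
  case/andP=> /existsP[f /andP[]]; rewrite !inE => /orP[/eqP-> exz|fT fxz].
    move=> /IHp{}IHp /IHp{IHp}.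
    case: (joins_inj euv exz) => -[-> ->]; rewrite !connect0 /=.
      by case/or3P=> [->|/andP[_ ->]|->]; rewrite ?orbT.
    by case/or3P=> [->|->|/andP[_ ->]]; rewrite ?orbT.
  move=> /IHp{}IHp /IHp{IHp}; have xz := conn_edge fT fxz.
  by case/or3P=> [/(connect_trans xz)->|/andP[/(connect_trans xz)-> ->]
                 |/andP[/(connect_trans xz)-> ->]]; rewrite ?orbT.
case/or3P=> [|/andP[xu vy]|/andP[xv uy]]; first exact: conn_subset.
  exact: connect_trans (connect_trans (conn_subset sT xu) Cuv) (conn_subset sT vy).
rewrite conn_sym in Cuv.
exact: connect_trans (connect_trans (conn_subset sT xv) Cuv) (conn_subset sT uy).
Qed.

Lemma walk_cat x es1 es2 vs : walk x (es1 ++ es2) vs ->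
  exists vs1 vs2, [/\ vs = vs1 ++ vs2, walk x es1 vs1
                    & walk (last x vs1) es2 vs2].
Proof.
elim: es1 x vs => [|e es1 IH] x vs /=; first by exists [::], vs.
case: vs => // v vs /andP[exv /IH[vs1 [vs2 [-> W1 W2]]]].
by exists (v :: vs1), vs2; rewrite /= exv.
Qed.

Lemma walk_conn T x es vs :
  walk x es vs -> {subset es <= T} -> conn T x (last x vs).
Proof.
elim: es x vs => [|e es IH] x [|v vs] //= /andP[exv W] sT.
apply: connect_trans (conn_edge _ exv) (IH _ _ W _).
  by rewrite sT ?mem_head.
by move=> f f_es; rewrite sT ?inE ?f_es ?orbT.
Qed.

Lemma path_walk T x vs : path (adjacent T) x vs ->
  exists2 es, walk x es vs & {subset es <= T}.
Proof.
elim: vs x => [|v vs IH] x /=; first by exists [::].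
case/andP=> /existsP[e /andP[eT exv]] /IH[es W sT].
by exists (e :: es) => [/=|f]; rewrite ?exv // inE => /predU1P[->|/sT].
Qed.

Lemma walk_ends x es vs e :
  walk x es vs -> e \in es -> {subset ends e <= x :: vs}.
Proof.
elim: es x vs => [|f es IH] x [|v vs] //= /andP[fxv W].
rewrite inE => /predU1P[-> y|/(IH _ _ W) sub y /sub]; last first.
  by rewrite !inE => ->; rewrite orbT.
by rewrite (eqP fxv) !inE => /orP[]->; rewrite ?orbT.
Qed.

(** If the first edge occurred again, the rest of the walk would revisit its endpoint [x]. *)
Lemma walk_uniq x es vs : walk x es vs -> uniq (x :: vs) -> uniq es.
Proof.
elim: es x vs => [|e es IH] x [|v vs] //= /andP[exv W] /andP[xv uv].
rewrite (IH _ _ W uv) andbT; apply: contra xv => /(walk_ends W); apply.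
by rewrite (eqP exv) !inE eqxx.
Qed.

(** * Acyclicity *)

Lemma acyclic_subset T E : T \subset E -> acyclic E -> acyclic T.
Proof.
move=> /subsetP sTE /acyclicP aE; apply/acyclicP => -[es [vs [C sT]]].
by apply: aE; exists es, vs; split=> // f /sT/sTE.
Qed.

(** A cycle through [e] consists of [e] and a path of [T] between its ends. *)
Lemma acyclic_add T e u v : e \notin T -> joins e u v ->
  acyclic (e |: T) = acyclic T && ~~ conn T u v.
Proof.
move=> eT euv; apply/idP/andP=> [aeT|[/acyclicP aT nuv]].
  split; first exact: acyclic_subset (subsetUr _ _) aeT.
  apply/negP=> /connectP[p /shortenP[p' p'T uniq_p' _] def_v].
  have [es W sT] := path_walk p'T.
  case/acyclicP: aeT; exists (e :: es), (u :: p'); split.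
    rewrite /is_cycle uniq_p' /= -def_v joinsC euv W (walk_uniq W uniq_p') !andbT.
    by apply: contra eT => /sT.
  by move=> f; rewrite !inE => /predU1P[->|/sT->]; rewrite ?eqxx ?orbT.
apply/acyclicP=> -[es [vs [C sT]]].
have [e_es|e_es] := boolP (e \in es); last first.
  case: aT; exists es, vs; split=> // f f_es; have := sT f f_es.
  by rewrite !inE => /predU1P[def_f|//]; rewrite -def_f f_es in e_es.
case: vs C => //= x vs /and3P[ues _].
case/splitPr: e_es ues sT => s1 s2 ues sT.
rewrite /= in ues; move=> /walk_cat[vs1 [[|z vs2] [def_vs W1 //=]]].
case/andP=> ez W2.
have{ues} /andP[e1 e2] : (e \notin s1) && (e \notin s2).
  by move: ues; rewrite cat_uniq /= => /and3P[_ /norP[-> _] /andP[->]].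
have s1T : {subset s1 <= T}.
  move=> f f1; have := sT f; rewrite mem_cat f1 => /(_ isT).
  by rewrite !inE => /predU1P[def_f|//]; rewrite -def_f f1 in e1.
have s2T : {subset s2 <= T}.
  move=> f f2; have := sT f; rewrite mem_cat inE f2 !orbT => /(_ isT).
  by rewrite !inE => /predU1P[def_f|//]; rewrite -def_f f2 in e2.
(* The two pieces of the cycle opened at [e] meet at [last x vs] and connect the ends of [e] within
   [T]. *)
have := connect_trans (walk_conn W2 s2T).
have -> : last z vs2 = last x vs.
  by have /(congr1 (last x)) /= := def_vs; rewrite last_cat.
move=> /(_ _ (walk_conn W1 s1T)) zy.
by case/negP: nuv; case: (joins_inj euv ez) zy => -[-> ->] //; rewrite conn_sym.
Qed.

(** * Trees and two-component forests *)

Definition is_tree W T := connected_on W T && acyclic T.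

(** The components of [u] and [v] are distinct and cover [W], so it meets no third one. *)
Definition is_two_forest W u v T :=
  [&& acyclic T, ~~ conn T u v & [forall x in W, conn T x u || conn T x v]].

Lemma connected_onP W T u : u \in W ->
  reflect {in W, forall x, conn T x u} (connected_on W T).
Proof.
move=> uW; apply: (iffP andP) => [[_ /forall_inP cW] x xW|cW].
  by move/forall_inP: (cW x xW) => /(_ u uW).
split; first by apply/set0Pn; exists u.
apply/forall_inP=> x /cW xu; apply/forall_inP=> y /cW yu.
by apply: connect_trans xu _; rewrite conn_sym.
Qed.

Lemma is_two_forestC W u v T : is_two_forest W u v T = is_two_forest W v u T.
Proof.
rewrite /is_two_forest conn_sym; do 2!congr andb.
by apply: eq_forallb_in => x _; rewrite orbC.
Qed.

(** Removing an edge from a tree leaves two components, one at each end. *)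
Lemma is_tree_add W T e u v : e \notin T -> joins e u v -> u \in W ->
  is_tree W (e |: T) = is_two_forest W u v T.
Proof.
move=> eT euv uW; rewrite /is_tree (acyclic_add eT euv) andbC -andbA.
do 2!congr andb; apply/(connected_onP _ uW)/forall_inP => cW x xW.
  have := cW x xW; rewrite (conn_add _ _ _ euv).
  by case/or3P=> [|/andP[]|/andP[]] ->; rewrite ?orbT.
rewrite (conn_add _ _ _ euv) connect0 andbT.
by case/orP: (cW x xW) => ->; rewrite ?orbT.
Qed.

(** This is what makes a vertex outside [W] new: no edge of [E] touches it. *)
Definition confined W E := forall e, e \in E -> ends e \subset W.

Lemma confined_add W E e w u : confined W E -> joins e u w -> u \in W ->
  confined (w |: W) (e |: E).
Proof.
move=> cE euw uW f; rewrite in_setU1 => /predU1P[->|/cE sW].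
  rewrite (eqP euw); apply/subsetP=> x.
  by rewrite !inE => /orP[]/eqP->; rewrite ?uW ?eqxx ?orbT.
exact: subset_trans sW (subsetUr _ _).
Qed.

Lemma confined_walk W E x es vs : confined W E -> walk x es vs ->
  {subset x :: vs <= W} -> confined W (E :|: [set f in es]).
Proof.
move=> cE Wk sW f; rewrite !inE => /orP[/cE //|f_es].
by apply/subsetP=> y yf; apply/sW/(walk_ends Wk f_es).
Qed.

(** * Adding one vertex outside [W] *)

Section Pendant.

Variables (W : {set vertex G}) (E : {set edge G}) (w : vertex G).
Hypotheses (cE : confined W E) (wW : w \notin W).

Lemma pendant_notin e u : joins e u w -> e \notin E.
Proof.
move=> euw; apply: contra wW => /cE/subsetP-> //.
by rewrite (eqP euw) !inE eqxx orbT.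
Qed.

Lemma conn_isolated T y : T \subset E -> conn T w y = (y == w).
Proof.
move=> sTE; apply/idP/eqP => [|->]; last exact: connect0.
case/connectP=> -[|z p] //= /andP[/existsP[f /andP[fT fwz]] _] _.
case/negP: (wW); apply: (subsetP (cE (subsetP sTE f fT))).
by rewrite (eqP fwz) !inE eqxx.
Qed.

(** The component of [w] is [w] alone, so that of [v] must contain all of [W]. *)
Lemma is_two_forest_isolated T v : T \subset E -> v \in W ->
  is_two_forest (w |: W) w v T = is_tree W T.
Proof.
move=> sTE vW; have nwW x : x \in W -> (x == w) = false.
  by apply: contraTF => /eqP->.
rewrite /is_tree andbC /is_two_forest conn_isolated // nwW //=; congr andb.
apply/forall_inP/(connected_onP _ vW) => cW x; last first.
  rewrite in_setU1 => /predU1P[->|/cW->]; first by rewrite connect0.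
  by rewrite orbT.
move=> xW; have := cW x; rewrite in_setU1 xW orbT => /(_ isT).
by rewrite (conn_sym _ x w) conn_isolated // nwW.
Qed.

Lemma is_tree_isolated T v : T \subset E -> v \in W ->
  is_tree (w |: W) T = false.
Proof.
move=> sTE vW; apply/negP=> /andP[/connected_onP cW _].
have := cW v (setU1r _ vW) w (setU11 _ _); rewrite conn_isolated // => /eqP def_v.
by rewrite def_v (negPf wW) in vW.
Qed.

Lemma is_tree_pendant T e u : T \subset E -> joins e u w -> u \in W ->
  is_tree (w |: W) (e |: T) = is_tree W T.
Proof.
move=> sTE euw uW; rewrite (is_tree_add _ euw (setU1r _ uW)).
  by rewrite is_two_forestC is_two_forest_isolated.
by apply: contra (pendant_notin euw) => /(subsetP sTE).
Qed.

(** The edge [e] puts [w] in the component of [u], so [w] can stand for [u]. *)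
Lemma is_two_forest_pendant T e u v :
    T \subset E -> joins e u w -> u \in W -> v \in W ->
  is_two_forest (w |: W) w v (e |: T) = is_two_forest W u v T.
Proof.
move=> sTE euw uW vW; have nwW x : x \in W -> (x == w) = false.
  by apply: contraTF => /eqP->.
have eT : e \notin T by apply: contra (pendant_notin euw) => /(subsetP sTE).
have isoL x : x \in W -> conn T w x = false.
  by move=> xW; rewrite conn_isolated // nwW.
have isoR x : x \in W -> conn T x w = false.
  by move=> xW; rewrite conn_sym isoL.
rewrite /is_two_forest (acyclic_add eT euw) isoR // andbT; congr andb.
rewrite (conn_add _ _ _ euw) (isoL v) ?(isoL u) //= connect0; congr andb.
apply/forall_inP/forall_inP => cW x.
  move=> xW; have := cW x; rewrite in_setU1 xW orbT => /(_ isT).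
  rewrite !(conn_add _ _ _ euw) (isoR x) // (isoL v) // connect0 /=.
  by rewrite andbT andbF !orbF.
rewrite in_setU1 => /predU1P[->|xW]; first by rewrite connect0.
rewrite !(conn_add _ _ _ euw) (isoR x) // (isoL v) // connect0 /=.
by rewrite andbT andbF !orbF cW.
Qed.

End Pendant.

(** * Counting edge subsets *)

Definition num (E : {set edge G}) (Q : pred {set edge G}) : nat :=
  #|[set T in powerset E | Q T]|.

Lemma num_eq E (Q R : pred {set edge G}) :
  (forall T, T \subset E -> Q T = R T) -> num E Q = num E R.
Proof.
move=> eqQR; apply: eq_card => T; rewrite !inE.
by case: (boolP (T \subset E)) => //= /eqQR.
Qed.

Lemma num0 E (Q : pred {set edge G}) :
  (forall T, T \subset E -> Q T = false) -> num E Q = 0.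
Proof. by move/num_eq->; apply: eq_card0 => T; rewrite !inE andbF. Qed.

(** The subsets are split by membership of [e]; adding [e] is injective on the subsets of [E]. *)
Lemma num_add E e (Q : pred {set edge G}) : e \notin E ->
  num (e |: E) Q = num E Q + num E (fun T => Q (e |: T)).
Proof.
move=> eE; rewrite /num -(cardsID [set T : {set edge G} | e \in T]) addnC.
congr addn.
  apply: eq_card => T; rewrite !inE andbA; congr andb.
  have [eT|eT] := boolP (e \in T).
    by apply/esym/subsetP=> /(_ e eT); apply/negP.
  by rewrite -subDset (setDidPl _) // disjoint_sym disjoints1.
rewrite -[RHS](card_in_imset (f := fun T => e |: T)) => [|S T].
  apply: eq_card => T; rewrite !inE; apply/andP/imsetP => [[/andP[sT QT] eT]|[S]].
    by exists (T :\ e); rewrite ?inE setD1K // subDset sT.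
  by rewrite !inE => /andP[sS QS] ->; rewrite setUS ?setU11.
rewrite !inE => /andP[/subsetP sS _] /andP[/subsetP sT _].
move/(congr1 (fun A => A :\ e)); by rewrite !setU1K //; apply: contra eE; auto.
Qed.

(** Deletion-contraction, with two-component forests in place of the trees of the contracted
    graph. *)
Lemma num_tree_add W E e u v : e \notin E -> joins e u v -> u \in W ->
  num (e |: E) (is_tree W) = num E (is_tree W) + num E (is_two_forest W u v).
Proof.
move=> eE euv uW; rewrite num_add //; congr addn; apply: num_eq => T sTE.
by apply: is_tree_add euv uW; apply: contra eE => /(subsetP sTE).
Qed.

Section PendantNum.

Variables (W : {set vertex G}) (E : {set edge G}) (e : edge G).
Variables (u w : vertex G).
Hypotheses (cE : confined W E) (wW : w \notin W) (euw : joins e u w).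
Hypothesis uW : u \in W.

Lemma num_tree_pendant : num (e |: E) (is_tree (w |: W)) = num E (is_tree W).
Proof.
rewrite num_add ?(pendant_notin cE wW euw) // num0 => [|T sTE].
  by apply: num_eq => T sTE; rewrite (is_tree_pendant cE wW sTE euw).
exact: (is_tree_isolated cE wW sTE uW).
Qed.

(** Without [e], [w] is a component by itself and the rest is a tree; with [e], it joins the
    component of [u]. *)
Lemma num_two_forest_pendant v : v \in W ->
  num (e |: E) (is_two_forest (w |: W) w v) =
  num E (is_tree W) + num E (is_two_forest W u v).
Proof.
move=> vW; rewrite num_add ?(pendant_notin cE wW euw) //.
congr addn; apply: num_eq => T sTE.
  by rewrite (is_two_forest_isolated cE wW).
by rewrite (is_two_forest_pendant cE wW sTE euw).
Qed.

End PendantNum.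

(** * Adding a path, and deleting one of its edges *)

Lemma set_cons (A : finType) (a : A) (s : seq A) :
  [set x in a :: s] = a |: [set x in s].
Proof. by apply/setP=> x; rewrite !inE. Qed.

Lemma set_nil (A : finType) : [set x in [::] : seq A] = set0.
Proof. by apply/setP=> x; rewrite !inE. Qed.

Lemma disjoint_setU1 (A : finType) (s : seq A) a (B : {set A}) :
  [disjoint s & a |: B] = (a \notin s) && [disjoint s & B].
Proof.
rewrite !(disjoint_sym (mem s)) -disjointU1.
by apply: eq_disjoint => x; rewrite !inE.
Qed.

Lemma num_tree_add_path W E u v es ws :
    confined W E -> u \in W -> v \in W -> walk u es (rcons ws v) ->
    uniq es -> [disjoint es & E] -> uniq ws -> [disjoint ws & W] ->
  num (E :|: [set f in es]) (is_tree (W :|: [set x in ws])) =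
  size es * num E (is_tree W) + num E (is_two_forest W u v).
Proof.
elim: ws W E u es => [|w ws IH] W E u [|e es] //= cE uW vW.
  case: es => [|f es] /=; last by rewrite andbF.
  move=> /andP[euv _] _; rewrite disjoint_cons => /andP[eE _] _ _.
  by rewrite mul1n set_nil set_cons set_nil !setU0 setUC (num_tree_add eE euv).
case/andP=> euw Wk /andP[e_es ues]; rewrite disjoint_cons => /andP[eE dE].
case/andP=> w_ws uws; rewrite disjoint_cons => /andP[wW dW].
(* The first edge and its new vertex [w] move into the base graph, and [w] replaces [u]. *)
rewrite !set_cons !(setUCA _ [set _]) !setUA (IH _ _ w) ?setU11 ?setU1r //.
- rewrite (num_tree_pendant cE wW euw uW) (num_two_forest_pendant cE wW euw) //.
  by rewrite addnA mulSn (addnC (num _ _)).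
- exact: confined_add euw uW.
- by rewrite disjoint_setU1 e_es.
by rewrite disjoint_setU1 w_ws.
Qed.

(** The path hangs at [v] only, so its vertices can be stripped as leaves from the free end [w]. *)
Lemma num_tree_pendant_path W E w v es ws :
    confined W E -> v \in W -> walk w es (rcons ws v) ->
    uniq (w :: ws) -> [disjoint w :: ws & W] ->
  num (E :|: [set f in es]) (is_tree (W :|: [set x in w :: ws])) =
  num E (is_tree W).
Proof.
elim: ws w es => [|w2 ws IH] w [|e es] cE vW //=.
  case: es => [|f es] /=; last by rewrite andbF.
  move=> /andP[ewv _] _; rewrite disjoint_cons => /andP[wW _].
  rewrite !set_cons !set_nil !setU0 setUC (setUC W).
  by rewrite joinsC in ewv; apply: num_tree_pendant ewv vW.
case/andP=> eww2 Wk uws; rewrite disjoint_cons => /andP[wW dW].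
have /andP[w_ws uws2] := uws.
(* The tail of the path is put back first; then [w] is pendant at [w2]. *)
rewrite -(IH w2 es) //= set_cons (set_cons w) !(setUCA _ [set _]).
rewrite joinsC in eww2; apply: num_tree_pendant eww2 _.
- apply: confined_walk Wk _.
    by move=> f /cE sW; apply: subset_trans sW (subsetUl _ _).
  move=> x; rewrite -rcons_cons mem_rcons in_cons !inE => /predU1P[->|->].
    by rewrite vW.
  by rewrite orbT.
- by rewrite !inE negb_or wW.
by rewrite !inE eqxx orbT.
Qed.

(** Without [e] the path falls into two pendant paths, at [u] and at [v], possibly empty. *)
Lemma num_tree_path_del W E u v e es ws :
    confined W E -> u \in W -> v \in W -> walk u es (rcons ws v) ->
    uniq es -> [disjoint es & E] -> uniq ws -> [disjoint ws & W] -> e \in es ->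
  num ((E :|: [set f in es]) :\ e) (is_tree (W :|: [set x in ws])) =
  num E (is_tree W).
Proof.
elim: ws W E u es => [|w ws IH] W E u [|e1 es] //= cE uW vW.
  case: es => [|f es] /=; last by rewrite andbF.
  move=> _ _; rewrite disjoint_cons => /andP[eE _] _ _.
  by rewrite inE => /eqP->; rewrite !set_cons !set_nil !setU0 setUC setU1K.
case/andP=> euw Wk /andP[e_es ues]; rewrite disjoint_cons => /andP[eE dE].
move=> /= uws dW; have /andP[w_ws uws'] := uws.
have /andP[wW dW'] : (w \notin W) && [disjoint ws & W] by rewrite -disjoint_cons.
rewrite inE => /predU1P[->|e_in].
  (* If the first edge is the deleted one, the rest of the path hangs at [v]. *)
  rewrite (set_cons e1) setUCA setU1K ?inE ?negb_or ?eE //.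
  exact: num_tree_pendant_path Wk _ _.
rewrite !set_cons !(setUCA _ [set _]) !setUA (IH _ _ w) ?setU11 ?setU1r //.
- exact: num_tree_pendant euw uW.
- exact: confined_add euw uW.
- by rewrite disjoint_setU1 e_es.
by rewrite disjoint_setU1 w_ws.
Qed.

(** A forest separating [u] from [v] cannot contain [e], and adding [e] yields exactly the trees
    through [e]. *)
Lemma num_two_forest_edge W E e u v : e \in E -> joins e u v -> u \in W ->
  num E (is_two_forest W u v) + num (E :\ e) (is_tree W) = num E (is_tree W).
Proof.
move=> eE euv uW; have e_E : e \notin E :\ e by rewrite !inE eqxx.
rewrite -{1 3}(setD1K eE) (num_tree_add e_E euv uW) addnC num_add //.
congr addn; rewrite [X in _ + X]num0 ?addn0 // => T _.
by rewrite /is_two_forest (conn_edge (setU11 e T) euv) andbF.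
Qed.

(** * The recurrence *)

Lemma tauE (H : subgraph G) : tau H = num (edges H) (is_tree (verts H)).
Proof. by apply: eq_card => T; rewrite !inE. Qed.

End SpanningTrees.

Local Open Scope ring_scope.

Theorem theorem3p3 (n : nat) (k : nat -> nat) (G : multigraph)
    (H : nat -> subgraph G)
    (hn : (3 <= n)%N)
    (hk : forall i : nat, (1 <= i <= n)%N -> (2 <= k i)%N)
    (hH : stack_of_polygons n k H) :
  (tau (H n))%:Z = (k n)%:Z * (tau (H (n - 1)%N))%:Z - (tau (H (n - 2)%N))%:Z.
Proof.
have [P [_ P1 attach]] := hH.
case: n hn hk attach {hH} => [|[|m]] // m_gt0 hk attach.
(* From here on [n] is the middle index: the graphs are [H n.+1], [H n] and [H m], with [m] at least
   1. *)
rewrite !subSS !subn0; set n := m.+1.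
have cH i : confined (verts (H i)) (edges (H i)) by move=> f; apply: subgraphP.
(* This places the edge [e1], chosen in [P m], in [H m]; index 1 is the initial polygon. *)
have sP : P m \subset edges (H m).
  have [m1|m1] := leqP m 1.
    by have -> : m = 1%N; [apply/eqP; rewrite eqn_leq m1 | rewrite P1].
  have [|_ [_ [_ [es [_ [_ _ _ _ [_ _ ->]]]]]]] := attach m.
    by rewrite m1 leqW ?leqW.
  exact: subsetUr.
have [|e1 [u1 [v1 [es1 [ws1 [[e1P e1uv] [_ ues1 des1] [_ uws1 dws1] Wk1
  [defP V1 E1]]]]]]] := attach n; first by apply/andP; split; [exact: m_gt0|].
have [|e [u [v [es [ws [[eP euv] [szes ues des] [_ uws dws] Wk
  [defP' V E]]]]]]] := attach n.+1; first by rewrite leqnn andbT.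
have k_gt1 : (1 < k n.+1)%N by apply: hk; rewrite leqnn.
have sends i f x y : f \in edges (H i) -> joins f x y ->
    x \in verts (H i) /\ y \in verts (H i).
  by move=> /cH/subsetP sV /eqP xy; split; apply: sV; rewrite xy ?set21 ?set22.
have [u1V v1V] := sends m e1 u1 v1 (subsetP sP _ e1P) e1uv.
have eE : e \in edges (H n) by rewrite E1 inE eP orbT.
have [uV vV] := sends n e u v eE euv.
(* The additive form avoids truncated subtraction in [nat]. *)
have num_n1 : (tau (H n.+1) + tau (H m) = k n.+1 * tau (H n))%N.
  rewrite !tauE V E defP' (num_tree_add_path (cH n) uV vV Wk) // szes.
  (* As [e] lies on the path added to [H m], [tau (H m)] becomes the number of trees of [H n]
     avoiding [e]. *)
  rewrite -(num_tree_path_del (e := e) (cH m) u1V v1V Wk1) //; last first.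
    by rewrite defP inE in eP.
  rewrite -defP -E1 -V1 -addnA (num_two_forest_edge eE euv uV).
  (* The new path has [k n.+1 - 1] edges, a truncated difference, so [k n.+1] must be positive. *)
  by rewrite -mulSnr subn1 prednK // ltnW.
by rewrite -PoszM -num_n1 PoszD GRing.addrK.
Qed.
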